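(* For $k=1,\dots,K$ let $v_k$ with $0\le v_k\le 1$ satisfy $v_k\sum_{i=1}^{n_k}\|M^{k(i)}\|_2\|N_{k(i)}\|_2=\|M^kN_k\|_F$, and assume $\theta_1\le 1-v_k^2\le\theta_2$ for all $k$, where $0<\theta_1\le\theta_2\le 1$. Let $0<\beta\le 1$ and $$\varphi=\frac{(\theta_2-\theta_1\beta+\theta_2\theta_1\beta)^{1/2}}{(\theta_2\theta_1)^{1/4}}.$$ Let $C,D$ be produced by the block sampling algorithm (see context) with sampling probabilities satisfying $$p_{k_i}\ge\frac{\beta\|M^{k(i)}\|_2\|N_{k(i)}\|_2}{\sum_{i'=1}^{n_k}\|M^{k(i')}\|_2\|N_{k(i')}\|_2},\qquad k=1,\dots,K,\ i=1,\dots,n_k,$$ and with sampling block sizes $$c_k=c\,\frac{\Big(\big(\sum_{i=1}^{n_k}\|M^{k(i)}\|_2\|N_{k(i)}\|_2\big)^2-\|M^kN_k\|_F^2\Big)^{1/2}}{\sum_{l=1}^{K}\Big(\big(\sum_{i=1}^{n_l}\|M^{l(i)}\|_2\|N_{l(i)}\|_2\big)^2-\|M^lN_l\|_F^2\Big)^{1/2}},\qquad k=1,\dots,K.$$ Then $$\sum_{h=1}^{m}\sum_{f=1}^{p}\sigma_{h,f}^2\le\frac{\varphi^2}{\beta c}\|M\|_F^2\|N\|_F^2,$$ and, for $\delta\in(0,1)$ and $\eta=\varphi+\left(\frac{\theta_2}{\theta_1}\right)^{1/2}\sqrt{(8/\beta)\log(1/\delta)}$, the inequality $$\|MN-CD\|_F^2\le\frac{\eta^2}{\beta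 c}\|M\|_F^2\|N\|_F^2$$ holds with probability at least $1-\delta$.
   Context: $M\in\mathbb{R}^{m\times n}$ and $N\in\mathbb{R}^{n\times p}$ are partitioned conformally as $M=[M^1\ \cdots\ M^K]$ with $M^k\in\mathbb{R}^{m\times n_k}$ and $N^T=[N_1^T\ \cdots\ N_K^T]$ with $N_k\in\mathbb{R}^{n_k\times p}$, $\sum_{k=1}^K n_k=n$. $M^{k(i)}$ is the $i$-th column of $M^k$, $N_{k(i)}$ the $i$-th row of $N_k$, $M^k_{(h,i)}$ and $N_{k(i,f)}$ the corresponding entries. $\|\cdot\|_2$ is the Euclidean norm, $\|\cdot\|_F$ the Frobenius norm. Block sampling algorithm. Input: the matrices $M=[M^1\ \cdots\ M^K]\in\mathbb{R}^{m\times n}$ and $N\in\mathbb{R}^{n\times p}$ with $N^T=[N_1^T\ \cdots\ N_K^T]$, where $M^k\in\mathbb{R}^{m\times n_k}$, $N_k\in\mathbb{R}^{n_k\times p}$ and $\sum_{k=1}^K n_k=n$, positive integers $c_1,\dots,c_K$ with $1\le c_k\le n_k$ and $\sum_k c_k=c$, and probabilities $p_{k_i}\ge0$ with $\sum_{i=1}^{n_k}p_{k_i}=1$ for each $k$. For each block $k$, independently across blocks, draw $i_1,\dots,i_{c_k}\in\{1,\dots,n_k\}$ independently with replacement with $\Pr(i_t=s)=p_{k_s}$; let $C^k\in\mathbb{R}^{m\times c_k}$ have $t$-th column $M^{k(i_t)}/\sqrt{c_kp_{k_{i_t}}}$ and $D_k\in\mathbb{R}^{c_k\times p}$ have $t$-th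 row $N_{k(i_t)}/\sqrt{c_kp_{k_{i_t}}}$. Output $C=[C^1\ \cdots\ C^K]$, $D^T=[D_1^T\ \cdots\ D_K^T]$, and $CD=\sum_{k=1}^{K}C^kD_k$. The asymptotic variance of the $(h,f)$ entry is $$\sigma_{h,f}^2=\sum_{k=1}^{K}\sum_{i=1}^{n_k}\frac{(M^k_{(h,i)})^2(N_{k(i,f)})^2}{c_kp_{k_i}}-\sum_{k=1}^{K}\frac{((M^kN_k)_{(h,f)})^2}{c_k},$$ with terms $0/0$ read as $0$. The prescribed $c_k$ are assumed to be admissible inputs (positive integers with $c_k\le n_k$), and all denominators in the formulas are assumed nonzero. *)

(* Defs.v *)
From mathcomp Require Import all_boot all_order all_algebra.
From mathcomp Require Import all_classical all_reals all_analysis.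

Set Implicit Arguments.
Unset Strict Implicit.
Unset Printing Implicit Defensive.

Import Order.TTheory GRing.Theory Num.Theory.
Import numFieldNormedType.Exports.

Local Open Scope classical_set_scope.
Local Open Scope ring_scope.

(* The library's norm on matrices is the max norm, hence these. *)
Definition frob_norm (R : realType) (m n : nat) (A : 'M[R]_(m, n)) : R :=
  Num.sqrt (\sum_(h < m) \sum_(f < n) A h f ^+ 2).

Definition col_norm2 (R : realType) (m n : nat) (A : 'M[R]_(m, n))
    (i : 'I_n) : R :=
  Num.sqrt (\sum_(h < m) A h i ^+ 2).

Definition row_norm2 (R : realType) (n p : nat) (B : 'M[R]_(n, p))
    (i : 'I_n) : R :=
  Num.sqrt (\sum_(f < p) B i f ^+ 2).

Definition norm_prod_sum (R : realType) (m n p : nat)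
    (A : 'M[R]_(m, n)) (B : 'M[R]_(n, p)) : R :=
  \sum_(i < n) col_norm2 A i * row_norm2 B i.

Definition mutually_independent (R : realType) (d : measure_display)
    (T : measurableType d) (P : probability T R) (J : finType)
    (S : J -> finType) (X : forall j : J, T -> S j) : Prop :=
  forall (A : {set J}) (B : forall j : J, set (S j)),
    P (\bigcap_(j in [set` A]) (X j @^-1` B j)) =
    (\prod_(j in A) P (X j @^-1` B j))%E.

(* [idx k t w] is the index drawn at the t-th trial in block k; indices carry
   the discrete sigma-algebra.  Independence is that of the whole family of
   draws, indexed by the pairs (k, t), both within and across blocks. *)
Record block_sampling (R : realType) (d : measure_display)
    (T : measurableType d) (P : probability T R) (K : nat)
    (n_ c_ : 'I_K -> nat) (pr : forall k : 'I_K, 'I_(n_ k) -> R)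
    (idx : forall k : 'I_K, 'I_(c_ k) -> T -> 'I_(n_ k)) : Prop :=
  BlockSampling {
    block_sampling_measurable : forall k t (B : set 'I_(n_ k)),
      measurable (idx k t @^-1` B) ;
    block_sampling_law : forall k t (s : 'I_(n_ k)),
      P (idx k t @^-1` [set s]) = (pr k s)%:E ;
    block_sampling_independent :
      @mutually_independent R d T P {k : 'I_K & 'I_(c_ k)}
        (fun j => 'I_(n_ (tag j))) (fun j => idx (tag j) (tagged j)) }.

Section Sketch.
Variables (R : realType) (m p K : nat) (n_ c_ : 'I_K -> nat).
Variables (M : 'M[R]_(m, \sum_(k < K) n_ k)).
Variables (N : 'M[R]_(\sum_(k < K) n_ k, p)).

(* [s] is a realization of all the draws.  A draw of probability 0 gives a zero
   column and row here (x / 0 = 0), but it occurs with probability 0. *)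
Definition sketch_C (pr : forall k : 'I_K, 'I_(n_ k) -> R)
    (s : forall k : 'I_K, 'I_(c_ k) -> 'I_(n_ k)) :
    'M[R]_(m, \sum_(k < K) c_ k) :=
  \mxrow_(k < K) \matrix_(h < m, t < c_ k)
    (submxrow M k h (s k t) / Num.sqrt ((c_ k)%:R * pr k (s k t))).

Definition sketch_D (pr : forall k : 'I_K, 'I_(n_ k) -> R)
    (s : forall k : 'I_K, 'I_(c_ k) -> 'I_(n_ k)) :
    'M[R]_(\sum_(k < K) c_ k, p) :=
  \mxcol_(k < K) \matrix_(t < c_ k, f < p)
    (submxcol N k (s k t) f / Num.sqrt ((c_ k)%:R * pr k (s k t))).

(* Terms 0 / 0 are 0 by the library convention x / 0 = 0. *)
Definition asym_var (pr : forall k : 'I_K, 'I_(n_ k) -> R)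
    (h : 'I_m) (f : 'I_p) : R :=
  \sum_(k < K) \sum_(i < n_ k)
    (submxrow M k h i ^+ 2 * submxcol N k i f ^+ 2) / ((c_ k)%:R * pr k i)
  - \sum_(k < K) (submxrow M k *m submxcol N k) h f ^+ 2 / (c_ k)%:R.

Definition block_weight (k : 'I_K) : R :=
  Num.sqrt (norm_prod_sum (submxrow M k) (submxcol N k) ^+ 2
            - frob_norm (submxrow M k *m submxcol N k) ^+ 2).

End Sketch.

Definition phi_const (R : realType) (theta1 theta2 beta : R) : R :=
  Num.sqrt (theta2 - theta1 * beta + theta2 * theta1 * beta)
  / (theta2 * theta1) `^ (4^-1).

Definition eta_const (R : realType) (theta1 theta2 beta delta : R) : R :=
  phi_const theta1 theta2 beta
  + Num.sqrt (theta2 / theta1) * Num.sqrt (8 / beta * ln (1 / delta)).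

(* Main.v *)
(** The error [CD - MN] is a sum, over all draws [(k, t)], of independent centered
    random matrices.  Its expected squared Frobenius norm is therefore the sum of
    the entrywise variances, and by Jensen's inequality the expected norm is at most
    the square root of that sum.  Redrawing one index of block [k] changes the norm
    by at most [2 S_k / (beta c_k)], where [S_k] is the sum over the block of the
    products of column and row norms, so McDiarmid's inequality bounds the deviation
    of the norm from its mean.  With [a_k = sqrt (1 - v_k^2)] the block sizes are
    [c_k = c S_k a_k / sum_l S_l a_l]; since [sqrt theta1 <= a_k <= sqrt theta2],
    both the variance and the sum of the squared differences are bounded in terms of
    [(sum_k S_k)^2], which Cauchy-Schwarz bounds by [||M||_F^2 ||N||_F^2]. *)

Require Import Defs.
From mathcomp Require Import all_boot all_order all_algebra ring lra.
From mathcomp Require Import all_classical all_reals all_analysis.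

Set Implicit Arguments.
Unset Strict Implicit.
Unset Printing Implicit Defensive.

Import Order.TTheory GRing.Theory Num.Theory.
Import numFieldNormedType.Exports.

Local Open Scope classical_set_scope.
Local Open Scope ring_scope.

(** * Concentration on finite product spaces *)

(** Compares the power series coefficients of the hyperbolic cosine of [x] and of
    [expR (x ^+ 2 / 2)]. *)
Lemma leq_expn2_fact (n : nat) : (2 ^ n * n`! <= (n.*2)`!)%N.
Proof.
elim: n => [//|n IHn]; rewrite doubleS !factS expnS.
rewrite -doubleS -mul2n mulnACA leq_mul2l orFb.
exact/(leq_trans IHn)/leq_pmull.
Qed.

(** Partial sums are compared term by term: the odd powers cancel, and the even ones are controlled
    by [leq_expn2_fact]. *)
Lemma expR_add_expRN_le (R : realType) (x : R) :
  expR x + expR (- x) <= 2 * expR (x ^+ 2 / 2).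
Proof.
have partial n : series (exp_coeff x) (n * 2)%N + series (exp_coeff (- x)) (n * 2)%N
    <= 2 * series (exp_coeff (x ^+ 2 / 2)) n.
  elim: n => [|n IHn]; first by rewrite /series /= !big_geq// addr0 mulr0.
  rewrite mulSn /series /= !big_nat_recr//= mulrDr.
  have ge0 : (0 : R) <= (x ^+ 2) ^+ n by rewrite exprn_ge0// sqr_ge0.
  have even : exp_coeff x (n * 2)%N + exp_coeff (- x) (n * 2)%N
      <= 2 * exp_coeff (x ^+ 2 / 2) n.
    rewrite /exp_coeff /= ![(n * 2)%N]mulnC !exprM sqrrN -mulr2n -[leLHS]mulr_natl.
    rewrite ler_pM2l// expr_div_n -mulrA ler_wpM2l// -invfM.
    rewrite lef_pV2 ?posrE ?mulr_gt0 ?exprn_gt0 ?ltr0n ?fact_gt0//.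
    by rewrite -natrX -natrM ler_nat mul2n leq_expn2_fact.
  have odd : exp_coeff x (n * 2).+1 + exp_coeff (- x) (n * 2).+1 = 0.
    rewrite /exp_coeff /= !exprS ![(n * 2)%N]mulnC !exprM sqrrN.
    by rewrite !mulNr addrN.
  by move: IHn even odd; rewrite /series /=; lra.
have cvg2 (y : R) : series (exp_coeff y) (n * 2)%N @[n --> \oo] --> expR y.
  exact: (cvg_comp _ _ (@cvg_mulnr 2 isT) (is_cvg_series_exp_coeff y)).
have cvgr : 2 * series (exp_coeff (x ^+ 2 / 2)) n @[n --> \oo]
    --> 2 * expR (x ^+ 2 / 2).
  by apply: cvgMl_tmp; exact: is_cvg_series_exp_coeff.
have cvgl := cvgD (cvg2 x) (cvg2 (- x)).
apply: (ler_cvg_to (cvgl _) cvgr).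
by near=> n; exact: partial.
Unshelve. all: by end_near. Qed.

(* Hoeffding's lemma by symmetrization: Jensen bounds [expR (- mu)] by the mean of
   [expR (- f y)], and averaging [expR (f x - f y)] with its mirror image gives a
   hyperbolic cosine.  The constant [D ^+ 2 / 2], weaker than the optimal
   [D ^+ 2 / 8], suffices for the factor 8 in [eta_const]. *)
Lemma mean_expR_le (R : realType) (T : finType) (q f : T -> R) (D : R) :
  (forall x, 0 <= q x) -> \sum_x q x = 1 ->
  (forall x y, `|f x - f y| <= D) ->
  \sum_x q x * expR (f x) <= expR (\sum_x q x * f x + D ^+ 2 / 2).
Proof.
move=> q_ge0 q_sum1 f_diff; set mu := \sum_x q x * f x.
have jensen : expR (- mu) <= \sum_y q y * expR (- f y).
  (* The tangent line of the exponential at [- mu] has mean [expR (- mu)] and lies below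
     [expR (- f y)]. *)
  have -> : expR (- mu) = \sum_y q y * (expR (- mu) * (1 + (mu - f y))).
    under eq_bigr => y _ do rewrite mulrCA mulrDr mulr1 mulrBr.
    by rewrite -mulr_sumr big_split sumrB /= -mulr_suml q_sum1 mul1r subrr addr0 mulr1.
  apply: ler_sum => y _; rewrite ler_wpM2l//.
  rewrite [leRHS](_ : _ = expR (- mu) * expR (mu - f y)); last first.
    by rewrite -expRD addKr.
  by rewrite ler_wpM2l ?expR_ge0// expR_ge1Dx.
pose Z := \sum_x \sum_y q x * q y * expR (f x - f y).
have swap : Z = \sum_x \sum_y q x * q y * expR (- (f x - f y)).
  rewrite /Z exchange_big /=; apply: eq_bigr => x _; apply: eq_bigr => y _.
  by rewrite opprB [q y * _]mulrC.
have Zle : Z <= expR (D ^+ 2 / 2).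
  rewrite -(ler_pM2l (ltr0Sn R 1)) mulr_natl mulr2n {1}swap -big_split /=.
  have -> : 2 * expR (D ^+ 2 / 2)
      = \sum_x \sum_y q x * q y * (2 * expR (D ^+ 2 / 2)).
    under [RHS]eq_bigr => x _ do rewrite -mulr_suml -mulr_sumr q_sum1 mulr1.
    by rewrite -mulr_suml q_sum1 mul1r.
  apply: ler_sum => x _; rewrite -big_split /=; apply: ler_sum => y _.
  rewrite -mulrDr ler_wpM2l ?mulr_ge0// addrC.
  apply: le_trans (expR_add_expRN_le _) _.
  rewrite ler_pM2l// ler_expR ler_pM2r ?invr_gt0// -(ger0_norm (sqr_ge0 (_ - _))).
  by rewrite normrX lerXn2r ?nnegrE// (le_trans _ (f_diff x y)).
have -> : mu + D ^+ 2 / 2 = - (- mu) + D ^+ 2 / 2 by rewrite opprK.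
rewrite expRD expRN ler_pdivlMl ?expR_gt0// mulrC; apply: le_trans Zle.
apply: le_trans (ler_wpM2l _ jensen) _.
  by apply: sumr_ge0 => x _; rewrite mulr_ge0// expR_ge0.
rewrite mulr_suml; apply: ler_sum => x _; rewrite mulr_sumr.
by apply: ler_sum => y _; rewrite mulrACA -expRD.
Qed.

Local Notation dfwith := eqtype.dfwith.

Section ProductMean.
Context {R : realType} {J : finType} {S : J -> finType}.
Variable q : forall j, S j -> R.
Arguments q : clear implicits.
Hypothesis q_ge0 : forall j x, 0 <= q j x.
Hypothesis q_sum1 : forall j, \sum_x q j x = 1.
Implicit Types (f g : (forall j, S j) -> R) (s z : forall j, S j) (l : seq J).

Definition coord_mean g (j : J) s : R := \sum_x q j x * g (dfwith s x).

(* The iterated mean over all coordinates is the expectation under the product of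
   the laws [q j]; over fewer, it is a conditional expectation, as a function of the
   coordinates that have not been averaged. *)
Definition iter_mean l g : (forall j, S j) -> R := foldl coord_mean g l.

Lemma iter_mean_le l f g : (forall s, f s <= g s) ->
  forall s, iter_mean l f s <= iter_mean l g s.
Proof.
elim: l f g => [//|j l IHl] f g fg; apply: IHl => s.
by apply: ler_sum => x _; rewrite ler_wpM2l.
Qed.

Lemma iter_mean_cst l (a : R) : iter_mean l (fun=> a) = fun=> a.
Proof.
elim: l => [//|j l IHl]; rewrite -[RHS]IHl /iter_mean /=; congr foldl.
by apply/funext => s; rewrite /coord_mean -mulr_suml q_sum1 mul1r.
Qed.

Lemma iter_meanZ l (a : R) g s :
  iter_mean l (fun s => a * g s) s = a * iter_mean l g s.
Proof.
elim: l g => [//|j l IHl] g; rewrite -IHl /iter_mean /=; congr (foldl _ _ _ _).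
apply/funext => z; rewrite /coord_mean mulr_sumr.
by apply: eq_bigr => x _; rewrite mulrCA.
Qed.

Lemma iter_mean_sum l (I : Type) (r : seq I) (P : pred I)
    (F : I -> (forall j, S j) -> R) s :
  iter_mean l (fun s => \sum_(i <- r | P i) F i s) s =
  \sum_(i <- r | P i) iter_mean l (F i) s.
Proof.
elim: l F => [//|j l IHl] F; rewrite -IHl /iter_mean /=; congr (foldl _ _ _ _).
apply/funext => z; rewrite /coord_mean exchange_big /=.
by apply: eq_bigr => x _; rewrite mulr_sumr.
Qed.

Lemma iter_meanD l f g s :
  iter_mean l (fun s => f s + g s) s = iter_mean l f s + iter_mean l g s.
Proof.
elim: l f g => [//|j l IHl] f g; rewrite -IHl /iter_mean /=; congr (foldl _ _ _ _).
apply/funext => z; rewrite /coord_mean -big_split /=.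
by apply: eq_bigr => x _; rewrite mulrDr.
Qed.

(** Nonnegativity of the variance, the mean of [(g s - mu) ^+ 2]. *)
Lemma iter_mean_sqr l g s : iter_mean l g s ^+ 2 <= iter_mean l (fun s => g s ^+ 2) s.
Proof.
set mu := iter_mean l g s; rewrite -subr_ge0.
have -> : iter_mean l (fun s => g s ^+ 2) s - mu ^+ 2
    = iter_mean l (fun s => (g s - mu) ^+ 2) s.
  have -> : (fun s => (g s - mu) ^+ 2)
      = (fun s => g s ^+ 2 + (- (2 * mu) * g s + mu ^+ 2)).
    by apply/funext => z; ring.
  by rewrite !iter_meanD iter_meanZ iter_mean_cst -/mu; ring.
rewrite -[0](congr1 (@^~ s) (iter_mean_cst l 0)).
by apply: iter_mean_le => z; exact: sqr_ge0.
Qed.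

Lemma dfwith_same s j (x y : S j) : dfwith (dfwith s x) y = dfwith s y.
Proof.
apply/functional_extensionality_dep => i.
by case: eqtype.dfwithP => [|k jk]; rewrite ?dfwith_in// !dfwith_out.
Qed.

Lemma dfwith_swap s i j (x : S i) (y : S j) : i != j ->
  dfwith (dfwith s x) y = dfwith (dfwith s y) x.
Proof.
move=> ij; apply/functional_extensionality_dep => k.
have [<-{k}|jk] := eqVneq j k.
  by rewrite dfwith_in dfwith_out// dfwith_in.
rewrite (dfwith_out _ _ jk); have [<-{k jk}|ik] := eqVneq i k.
  by rewrite !dfwith_in.
by rewrite !dfwith_out.
Qed.

(** Lets bounded differences survive the successive averaging in [iter_mean_expR_le]. *)
Lemma coord_mean_bounded_diff g (D : J -> R) j :
  (forall s i (x y : S i), `|g (dfwith s x) - g (dfwith s y)| <= D i) ->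
  forall s i (x y : S i),
    `|coord_mean g j (dfwith s x) - coord_mean g j (dfwith s y)| <= D i.
Proof.
move=> g_diff s i x y; rewrite /coord_mean -sumrB.
have -> : D i = \sum_z q j z * D i by rewrite -mulr_suml q_sum1 mul1r.
apply: le_trans (ler_norm_sum _ _ _) _; apply: ler_sum => z _.
rewrite -mulrBr normrM ger0_norm// ler_wpM2l//.
(* If the redrawn coordinate is the averaged one, it is overwritten and the difference vanishes;
   [0 <= D i] then follows from [g_diff]. *)
have [ij|ij] := eqVneq i j; last by rewrite !(dfwith_swap _ _ _ ij).
subst j.
by rewrite !dfwith_same subrr normr0 (le_trans _ (g_diff s i x y)).
Qed.

(** The exponential moment bound behind McDiarmid's inequality: Hoeffding's lemma [mean_expR_le] is
    applied to one coordinate at a time, each costing [D j ^+ 2 / 2]. *)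
Lemma iter_mean_expR_le l g (D : J -> R) :
  (forall s i (x y : S i), `|g (dfwith s x) - g (dfwith s y)| <= D i) ->
  forall s, iter_mean l (fun s => expR (g s)) s
    <= expR (iter_mean l g s + \sum_(j <- l) D j ^+ 2 / 2).
Proof.
elim: l g => [|j l IHl] g g_diff s; first by rewrite big_nil addr0.
rewrite big_cons addrCA expRD.
apply: le_trans (ler_wpM2l (expR_ge0 _) (IHl _ (coord_mean_bounded_diff j g_diff) s)).
rewrite -iter_meanZ; apply: (@iter_mean_le l) => z; rewrite -expRD addrC.
exact: mean_expR_le.
Qed.

(** Averaging over coordinate [j] kills the cross term, since [y j] is centered, and leaves the
    second moment of [y j] plus the square of the remaining sum. *)
Lemma iter_mean_sqr_sum l (y : forall j, S j -> R) (a : R) s :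
  uniq l -> (forall j, \sum_x q j x * y j x = 0) ->
  iter_mean l (fun s => (a + \sum_(j <- l) y j (s j)) ^+ 2) s =
  a ^+ 2 + \sum_(j <- l) \sum_x q j x * y j x ^+ 2.
Proof.
move=> + y_mean0; elim: l a => [|j l IHl] a /=; first by rewrite !big_nil !addr0.
move=> /andP[jl uniq_l]; rewrite big_cons.
rewrite addrCA -(IHl a uniq_l) -[X in X + _](congr1 (@^~ s) (iter_mean_cst l _)).
rewrite -iter_meanD /iter_mean /=; congr (foldl _ _ _ _).
apply/funext => z; rewrite /coord_mean.
have others x : \sum_(i <- j :: l) y i (dfwith z (x : S j) i)
    = y j x + \sum_(i <- l) y i (z i).
  rewrite big_cons dfwith_in; congr (_ + _).
  apply: eq_big_seq => i il; rewrite dfwith_out//.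
  by apply: contraNneq jl => ->.
set b := a + \sum_(i <- l) y i (z i).
under [LHS]eq_bigr => x _.
  rewrite others (_ : _ * _ = q j x * y j x ^+ 2
    + ((q j x * y j x) * (2 * b) + q j x * b ^+ 2)).
    over.
  by rewrite /b; ring.
by rewrite !big_split /= -!mulr_suml y_mean0 q_sum1 mul0r add0r mul1r.
Qed.

(** [A] collects the coordinates already averaged, whose constraints are dropped; this generality
    carries the induction on [l]. *)
Lemma iter_mean_indicator l (A : {set J}) z s :
  uniq l -> (forall j, (j \in l) = (j \notin A)) ->
  iter_mean l (fun s => [forall j, (j \in A) || (s j == z j)]%:R) s =
  \prod_(j <- l) q j (z j).
Proof.
elim: l A => [|j l IHl] A; rewrite ?cons_uniq => /= uniq_l lA.
  rewrite big_nil (_ : [forall j, _])//; apply/forallP => j.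
  by have := lA j; rewrite in_nil; case: (j \in A).
case/andP: uniq_l => jl uniq_l.
have jA : j \notin A by rewrite -lA mem_head.
rewrite big_cons -(IHl (j |: A) uniq_l); last first.
  move=> i; rewrite !inE negb_or -lA inE; have [->|//] := eqVneq i j.
  exact/negbTE.
rewrite -iter_meanZ /iter_mean /=; congr (foldl _ _ _ _).
apply/funext => t; rewrite /coord_mean (bigD1 (z j))//= big1 ?addr0; last first.
  move=> x xz; rewrite (_ : [forall i, _] = false) ?mulr0//.
  by apply/forallP => /(_ j); rewrite dfwith_in (negbTE jA) (negbTE xz).
congr (_ * (nat_of_bool _)%:R); apply: eq_forallb => i; rewrite !inE.
have [->|ij] := eqVneq i j; first by rewrite dfwith_in eqxx orbT.
by rewrite dfwith_out// eq_sym.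
Qed.

End ProductMean.

(** Chernoff's method: the indicator is dominated by an exponential, whose mean is bounded by
    [iter_mean_expR_le]. *)
Lemma iter_mean_tail_le (R : realType) (J : finType) (S : J -> finType)
    (q : forall j, S j -> R) (g : (forall j, S j) -> R) (D : J -> R)
    (delta b : R) (s0 : forall j, S j) :
  (forall j x, 0 <= q j x) -> (forall j, \sum_x q j x = 1) ->
  (forall s i (x y : S i), `|g (dfwith s x) - g (dfwith s y)| <= D i) ->
  0 < \sum_j D j ^+ 2 -> 0 < delta < 1 ->
  iter_mean q (enum J) g s0 + Num.sqrt (2 * (\sum_j D j ^+ 2) * ln (1 / delta))
    <= b ->
  iter_mean q (enum J) (fun s => (b < g s)%R%:R) s0 <= delta.
Proof.
move=> q_ge0 q_sum1 g_diff; set V := \sum_j _ => V_gt0 /andP[d_gt0 d_lt1].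
set mu := iter_mean q _ g s0; set L := ln _; set t := Num.sqrt _ => b_ge.
have L_ge0 : 0 <= L by apply: ln_ge0; rewrite ler_pdivlMr// mul1r ltW.
have t_sqr : t ^+ 2 = 2 * V * L by rewrite sqr_sqrtr// !mulr_ge0// ltW.
(* This [lam] minimizes the exponent [lam ^+ 2 * V / 2 - lam * t], whose value becomes
   [- t ^+ 2 / (2 * V) = - L]. *)
pose lam := t / V.
have lam_ge0 : 0 <= lam by rewrite divr_ge0 ?sqrtr_ge0// ltW.
have markov s : (b < g s)%R%:R <= expR (- (lam * b)) * expR (lam * g s).
  rewrite -expRD addrC -mulrBr; case: ltP => [bg|_]; last exact: expR_ge0.
  by rewrite -expR0 ler_expR mulr_ge0// subr_ge0 ltW.
apply: le_trans (iter_mean_le q_ge0 _ markov s0) _; rewrite iter_meanZ.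
have scaled_diff s i (x y : S i) :
    `|lam * g (dfwith s x) - lam * g (dfwith s y)| <= lam * D i.
  by rewrite -mulrBr normrM ger0_norm// ler_wpM2l.
apply: le_trans (ler_wpM2l (expR_ge0 _)
  (iter_mean_expR_le q_ge0 q_sum1 _ scaled_diff s0)) _.
rewrite iter_meanZ -/mu big_enum /= -mulr_suml.
under eq_bigr => j _ do rewrite exprMn.
rewrite -mulr_sumr -/V -expRD.
have <- : expR (- L) = delta.
  by rewrite /L div1r lnV// opprK lnK.
rewrite ler_expR.
have lamV : lam * V = t by rewrite /lam divfK// gt_eqF.
have lamt : lam * t = 2 * L by rewrite /lam mulrAC -expr2 t_sqr mulrAC mulfK ?gt_eqF//.
have : lam * (mu + t) <= lam * b by rewrite ler_wpM2l.
rewrite mulrDr lamt expr2 -[lam * lam * V]mulrA lamV lamt.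
lra.
Qed.

(** * From the probability space to the finite product space *)

Section SampleSpace.
Context {R : realType} {J : finType} {S : J -> finType}.
Variable q : forall j, S j -> R.
Arguments q : clear implicits.
Hypothesis q_ge0 : forall j x, 0 <= q j x.
Hypothesis q_sum1 : forall j, \sum_x q j x = 1.
Context {d : measure_display} {T : measurableType d} {P : probability T R}.
Variable X : forall j, T -> S j.
Hypothesis X_measurable : forall j (B : set (S j)), measurable (X j @^-1` B).
Hypothesis X_law : forall j x, P (X j @^-1` [set x]) = (q j x)%:E.
Hypothesis X_indep : mutually_independent P X.

(** The intersection over the full index set has the shape that [mutually_independent] speaks of. *)
Let point (z : forall j, S j) : set T :=
  \bigcap_(j in [set` [set: J]%SET]) (X j @^-1` [set z j]).

Let measurable_point z : measurable (point z).
Proof. by apply: fin_bigcap_measurable => // j _; exact: X_measurable. Qed.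

Let event_points (E : (forall j, S j) -> bool) :
  [set w | E (X ^~ w)] =
  \bigcup_(z in [set z : {dffun forall j, S j} | E z]) point z.
Proof.
apply/seteqP; split => [w Ew|w [z Ez zw]].
  exists (finfun (X ^~ w)) => [|j _] /=; last by rewrite ffunE.
  by congr E: Ew; apply/functional_extensionality_dep => j; rewrite ffunE.
suff : X ^~ w = z :> (forall j, S j) by rewrite /= => ->.
by apply/functional_extensionality_dep => j; apply: zw; rewrite /= inE.
Qed.

(** The event is a finite disjoint union of outcomes; independence gives each outcome [z] the
    product of the [q j (z j)], which is also the iterated mean of its indicator. *)
Lemma probability_sample_event (E : (forall j, S j) -> bool) s0 :
  P [set w | E (X ^~ w)] = (iter_mean q (enum J) (fun s => (E s)%:R) s0)%:E.
Proof.
have -> : (fun s => (E s)%:R) = (fun s => \sum_(z : {dffun forall j, S j})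
    (E z)%:R * [forall j, (j \in finset.set0) || (s j == z j)]%:R) :> (_ -> R).
  apply/funext => s; rewrite (bigD1 (finfun s : {dffun forall j, S j}))//= big1 ?addr0.
    rewrite (_ : finfun s = s :> (forall j, S j)); last first.
      by apply/functional_extensionality_dep => j; rewrite ffunE.
    by rewrite (_ : [forall j, _]) ?mulr1//; apply/forallP => j; rewrite eqxx orbT.
  move=> z zs; rewrite (_ : [forall j, _] = false) ?mulr0//.
  apply: contraNF zs => /forallP sz; apply/eqP/ffunP => j; rewrite ffunE.
  by have := sz j; rewrite inE => /eqP.
rewrite iter_mean_sum event_points measure_fin_bigcup//;
  [|exact: finite_finset|]; last first.
  move=> y z _ _ [w [yw zw]]; apply/ffunP => j.
  have yj : X j w = y j by apply: yw; rewrite /= inE.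
  have zj : X j w = z j by apply: zw; rewrite /= inE.
  by rewrite -yj.
rewrite (_ : mkset _
  = [set` [seq z : {dffun forall j, S j} <- index_enum _ | E z]]); last first.
  by apply/seteqP; split=> z /=; rewrite mem_filter mem_index_enum andbT.
rewrite -fsbig_seq ?filter_uniq ?index_enum_uniq// big_filter -sumEFin big_mkcond.
apply: eq_bigr => z _; rewrite iter_meanZ iter_mean_indicator ?enum_uniq//; last first.
  by move=> j; rewrite mem_enum !inE.
case: (E z); last by rewrite mul0r.
rewrite mul1r; apply: etrans (X_indep [set: J]%SET (fun j => [set z j])) _.
rewrite big_enum /= -prodEFin.
by apply: eq_big => [j|j _]; rewrite ?inE// X_law.
Qed.
End SampleSpace.

(** * Frobenius norms *)

Section FrobeniusNorm.
Context {R : realType}.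

(** Cauchy-Schwarz by Lagrange's identity: the double sum of the squares
    [(a i * b j - a j * b i) ^+ 2] is twice the defect [P * Q - S ^+ 2]. *)
Lemma sum_mulr_le_sqrt (I : finType) (a b : I -> R) :
  \sum_i a i * b i <= Num.sqrt (\sum_i a i ^+ 2) * Num.sqrt (\sum_i b i ^+ 2).
Proof.
rewrite -sqrtrM ?sumr_ge0// => [|i _]; last exact: sqr_ge0.
apply: le_trans (ler_norm _) _; rewrite -sqrtr_sqr ler_wsqrtr//.
have : 0 <= \sum_i \sum_j (a i * b j - a j * b i) ^+ 2.
  by apply: sumr_ge0 => i _; apply: sumr_ge0 => j _; exact: sqr_ge0.
set P := \sum_i a i ^+ 2; set Q := \sum_i b i ^+ 2; set S := \sum_i a i * b i.
suff -> : \sum_i \sum_j (a i * b j - a j * b i) ^+ 2 = 2 * (P * Q - S ^+ 2).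
  by rewrite pmulr_rge0// subr_ge0.
transitivity (\sum_i (a i ^+ 2 * Q + b i ^+ 2 * P - a i * b i * (2 * S))).
  apply: eq_bigr => i _; rewrite !mulr_sumr -big_split -sumrB /=.
  by apply: eq_bigr => j _; ring.
by rewrite sumrB big_split /= -!mulr_suml -/P -/Q -/S; ring.
Qed.

Lemma sqrt_sumD_le (I : finType) (a b : I -> R) :
  Num.sqrt (\sum_i (a i + b i) ^+ 2)
  <= Num.sqrt (\sum_i a i ^+ 2) + Num.sqrt (\sum_i b i ^+ 2).
Proof.
have ge0 (u : I -> R) : 0 <= \sum_i u i ^+ 2.
  by apply: sumr_ge0 => i _; exact: sqr_ge0.
rewrite -[leRHS]ger0_norm ?addr_ge0 ?sqrtr_ge0// -sqrtr_sqr ler_wsqrtr//.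
rewrite sqrrD !sqr_sqrtr//.
under eq_bigr => i _ do rewrite sqrrD.
rewrite !big_split /= lerD2r lerD2l -mulr2n ler_pMn2r//.
exact: sum_mulr_le_sqrt.
Qed.

Variables m n : nat.
Implicit Types A B : 'M[R]_(m, n).

Lemma frob_norm_pair A :
  frob_norm A = Num.sqrt (\sum_(hf : 'I_m * 'I_n) A hf.1 hf.2 ^+ 2).
Proof. by rewrite /frob_norm pair_big. Qed.

Lemma frob_norm_ge0 A : 0 <= frob_norm A.
Proof. exact: sqrtr_ge0. Qed.

Lemma sqr_frob_norm A : frob_norm A ^+ 2 = \sum_h \sum_f A h f ^+ 2.
Proof.
rewrite sqr_sqrtr//; apply: sumr_ge0 => h _; apply: sumr_ge0 => f _.
exact: sqr_ge0.
Qed.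

Lemma frob_normN A : frob_norm (- A) = frob_norm A.
Proof.
congr Num.sqrt; apply: eq_bigr => h _; apply: eq_bigr => f _.
by rewrite mxE sqrrN.
Qed.

Lemma frob_normD A B : frob_norm (A + B) <= frob_norm A + frob_norm B.
Proof.
rewrite !frob_norm_pair; apply: le_trans (sqrt_sumD_le _ _).
by rewrite ler_wsqrtr//; apply: ler_sum => i _; rewrite mxE.
Qed.

Lemma frob_normB A B : frob_norm (A - B) <= frob_norm A + frob_norm B.
Proof. by rewrite -(frob_normN B); exact: frob_normD. Qed.

Lemma frob_norm_dist A B : `|frob_norm A - frob_norm B| <= frob_norm (A - B).
Proof.
have sub (C D : 'M[R]_(m, n)) : frob_norm C - frob_norm D <= frob_norm (C - D).
  by rewrite lerBlDr; apply: le_trans (frob_normD _ _); rewrite subrK.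
by rewrite ler_norml sub andbT lerNl opprB -[X in _ <= X]frob_normN opprB sub.
Qed.

End FrobeniusNorm.

Lemma sqr_frob_norm_rows (R : realType) (n p : nat) (B : 'M[R]_(n, p)) :
  frob_norm B ^+ 2 = \sum_i row_norm2 B i ^+ 2.
Proof.
rewrite sqr_frob_norm; apply: eq_bigr => i _.
by rewrite sqr_sqrtr// sumr_ge0// => f _; exact: sqr_ge0.
Qed.

Lemma sqr_frob_norm_cols (R : realType) (m n : nat) (A : 'M[R]_(m, n)) :
  frob_norm A ^+ 2 = \sum_i col_norm2 A i ^+ 2.
Proof.
rewrite sqr_frob_norm exchange_big; apply: eq_bigr => i _.
by rewrite sqr_sqrtr// sumr_ge0// => f _; exact: sqr_ge0.
Qed.

Lemma norm_prod_sum_le (R : realType) (m n p : nat)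
    (A : 'M[R]_(m, n)) (B : 'M[R]_(n, p)) :
  norm_prod_sum A B <= frob_norm A * frob_norm B.
Proof.
apply: le_trans (sum_mulr_le_sqrt _ _) _.
by rewrite -sqr_frob_norm_cols -sqr_frob_norm_rows !sqrtr_sqr !ger0_norm ?frob_norm_ge0.
Qed.

Lemma frob_norm_tr (R : realType) (m n : nat) (A : 'M[R]_(m, n)) :
  frob_norm A^T = frob_norm A.
Proof.
rewrite /frob_norm exchange_big; congr Num.sqrt.
by apply: eq_bigr => h _; apply: eq_bigr => f _; rewrite mxE.
Qed.

Lemma sqr_frob_norm_mxtrace (R : realType) (m n : nat) (A : 'M[R]_(m, n)) :
  frob_norm A ^+ 2 = \tr (A *m A^T).
Proof.
rewrite sqr_frob_norm; apply: eq_bigr => h _; rewrite mxE.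
by apply: eq_bigr => f _; rewrite mxE expr2.
Qed.

(** [M *m M^T] is the sum of the corresponding block products, and the trace is additive. *)
Lemma sqr_frob_norm_submxrow (R : realType) (m K : nat) (n_ : 'I_K -> nat)
    (M : 'M[R]_(m, \sum_(k < K) n_ k)) :
  frob_norm M ^+ 2 = \sum_k frob_norm (submxrow M k) ^+ 2.
Proof.
rewrite sqr_frob_norm_mxtrace -{1 2}(submxrowK M) tr_mxrow mul_mxrow_mxcol.
by rewrite raddf_sum; apply: eq_bigr => k _; rewrite sqr_frob_norm_mxtrace.
Qed.

Lemma sqr_frob_norm_submxcol (R : realType) (p K : nat) (n_ : 'I_K -> nat)
    (N : 'M[R]_(\sum_(k < K) n_ k, p)) :
  frob_norm N ^+ 2 = \sum_k frob_norm (submxcol N k) ^+ 2.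
Proof.
rewrite -frob_norm_tr sqr_frob_norm_submxrow; apply: eq_bigr => k _.
by rewrite -tr_submxcol frob_norm_tr.
Qed.

(** Cauchy-Schwarz acts twice: inside each block on column and row norms, then across blocks on
    Frobenius norms. *)
Lemma sum_norm_prod_sum_le (R : realType) (m p K : nat) (n_ : 'I_K -> nat)
    (M : 'M[R]_(m, \sum_(k < K) n_ k)) (N : 'M[R]_(\sum_(k < K) n_ k, p)) :
  \sum_k norm_prod_sum (submxrow M k) (submxcol N k) <= frob_norm M * frob_norm N.
Proof.
apply: le_trans (ler_sum _ (fun k _ => norm_prod_sum_le _ _)) _.
apply: le_trans (sum_mulr_le_sqrt _ _) _.
rewrite -sqr_frob_norm_submxrow -sqr_frob_norm_submxcol !sqrtr_sqr.
by rewrite !ger0_norm ?frob_norm_ge0.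
Qed.

(** * Norms of sums of independent random matrices *)

Section MatrixTail.
Context {R : realType} {J : finType} {S : J -> finType}.
Variable q : forall j, S j -> R.
Arguments q : clear implicits.
Hypothesis q_ge0 : forall j x, 0 <= q j x.
Hypothesis q_sum1 : forall j, \sum_x q j x = 1.
Context {m p : nat}.
Variable Y : forall j, S j -> 'M[R]_(m, p).
Arguments Y : clear implicits.

(** Jensen's inequality passes to the mean squared norm, where independence and centering leave only
    the diagonal terms. *)
Lemma iter_mean_frob_norm_le s0 :
  (forall j h f, \sum_x q j x * Y j x h f = 0) ->
  iter_mean q (enum J) (fun s => frob_norm (\sum_j Y j (s j))) s0
  <= Num.sqrt (\sum_h \sum_f \sum_j \sum_x q j x * Y j x h f ^+ 2).
Proof.
move=> Y_mean0.
apply: le_trans (ler_norm _) _; rewrite -sqrtr_sqr ler_wsqrtr//.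
apply: le_trans (iter_mean_sqr q_ge0 q_sum1 _ _ _) _.
under [X in iter_mean _ _ X]funext => s do rewrite sqr_frob_norm.
rewrite iter_mean_sum; apply: ler_sum => h _.
rewrite iter_mean_sum; apply: ler_sum => f _.
have -> : (fun s : forall j, S j => (\sum_j Y j (s j)) h f ^+ 2) =
    (fun s => (0 + \sum_(j <- enum J) Y j (s j) h f) ^+ 2).
  by apply/funext => s; rewrite add0r big_enum summxE.
rewrite (iter_mean_sqr_sum q_sum1 (y := fun j x => Y j x h f) _ _ (enum_uniq _))//.
by rewrite expr0n add0r big_enum.
Qed.

Lemma frob_norm_sum_diff (D : J -> R) :
  (forall j x y, frob_norm (Y j x - Y j y) <= D j) ->
  forall s i (x y : S i),
    `|frob_norm (\sum_j Y j (dfwith s x j)) - frob_norm (\sum_j Y j (dfwith s y j))|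
    <= D i.
Proof.
move=> Y_diff s i x y; apply: le_trans (frob_norm_dist _ _) _.
have others (t : S i) : \sum_j Y j (dfwith s t j)
    = Y i t + \sum_(j | j != i) Y j (s j).
  rewrite (bigD1 i)//= dfwith_in; congr (_ + _); apply: eq_bigr => j ji.
  by rewrite dfwith_out// eq_sym.
by rewrite !others opprD addrACA subrr addr0.
Qed.

End MatrixTail.

(** * Errors of single draws *)

Section SampledTerm.
Context {R : realType} {m n p : nat}.
Variables (A : 'M[R]_(m, n)) (B : 'M[R]_(n, p)) (pr : 'I_n -> R) (c : nat).

(** The contribution of one draw to the product of the sketches, whose two square-root scalings
    multiply to [c%:R * pr i]. *)
Definition sampled_term (i : 'I_n) : 'M[R]_(m, p) :=
  \matrix_(h, f) (A h i * B i f / (c%:R * pr i)).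

(** Each of the [c] draws is charged an equal share of the exact product, which centers it. *)
Definition sampled_dev (i : 'I_n) : 'M[R]_(m, p) :=
  sampled_term i - c%:R^-1 *: (A *m B).

Hypothesis pr_ge0 : forall i, 0 <= pr i.
Hypothesis pr_sum1 : \sum_i pr i = 1.
Hypothesis c_gt0 : (0 < c)%N.
Variable beta : R.
Hypothesis beta_gt0 : 0 < beta.
Hypothesis S_gt0 : 0 < norm_prod_sum A B.
Hypothesis pr_lower : forall i,
  beta * col_norm2 A i * row_norm2 B i / norm_prod_sum A B <= pr i.

Lemma norm_prod_le_pr i :
  col_norm2 A i * row_norm2 B i <= norm_prod_sum A B / beta * pr i.
Proof.
have := pr_lower i; rewrite ler_pdivrMr// -mulrA => le_pr.
by rewrite mulrAC ler_pdivlMr// mulrC [_ * pr i]mulrC.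
Qed.

Lemma sum_sqr_entries i :
  \sum_h \sum_f A h i ^+ 2 * B i f ^+ 2 = (col_norm2 A i * row_norm2 B i) ^+ 2.
Proof.
rewrite exprMn !sqr_sqrtr ?sumr_ge0// => [|h _|h _]; try exact: sqr_ge0.
by rewrite mulr_suml; apply: eq_bigr => h _; rewrite mulr_sumr.
Qed.

Lemma norm_prod_ge0 i : 0 <= col_norm2 A i * row_norm2 B i.
Proof. by rewrite mulr_ge0// sqrtr_ge0. Qed.

Lemma norm_prod_eq0 i : pr i = 0 -> col_norm2 A i * row_norm2 B i = 0.
Proof.
move=> pr0; apply/eqP; rewrite eq_le norm_prod_ge0 andbT.
by have := norm_prod_le_pr i; rewrite pr0 mulr0.
Qed.

(** Justifies reading [0 / 0] as 0: the lower bound on [pr] forces the product of norms to vanish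
    where [pr i = 0]. *)
Lemma entry_eq0 i h f : pr i = 0 -> A h i * B i f = 0.
Proof.
move=> /norm_prod_eq0 prod0; have := sum_sqr_entries i.
rewrite prod0 expr0n /= => /eqP.
have ge0 h' f' : 0 <= A h' i ^+ 2 * B i f' ^+ 2 by rewrite mulr_ge0 ?sqr_ge0.
rewrite psumr_eq0 => [/allP/(_ h (mem_index_enum _))/=|h' _]; last exact: sumr_ge0.
rewrite psumr_eq0// => /allP/(_ f (mem_index_enum _))/=.
by rewrite -exprMn sqrf_eq0 => /eqP.
Qed.

Lemma sampled_dev_mean0 h f : \sum_i pr i * sampled_dev i h f = 0.
Proof.
have c_neq0 : c%:R != 0 :> R by rewrite pnatr_eq0 -lt0n.
under eq_bigr => i _.
  rewrite !mxE (_ : _ * _ = (A h i * B i f) / c%:R - pr i * (c%:R^-1 * (A *m B) h f)).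
    over.
  rewrite mxE; have [pr0|pr_neq0] := eqVneq (pr i) 0; last by field; apply/andP.
  by rewrite (entry_eq0 _ _ pr0) pr0 !mul0r subrr.
by rewrite sumrB -!mulr_suml pr_sum1 mul1r mxE mulrC subrr.
Qed.

(** Both sides are [c] times the variance of an entry of one sampled term, the right one with the
    square expanded. *)
Lemma sampled_dev_second_moment h f :
  c%:R * (\sum_i pr i * sampled_dev i h f ^+ 2) =
  \sum_i (A h i ^+ 2 * B i f ^+ 2) / (c%:R * pr i) - (A *m B) h f ^+ 2 / c%:R.
Proof.
have c_neq0 : c%:R != 0 :> R by rewrite pnatr_eq0 -lt0n.
set s := (A *m B) h f; rewrite mulr_sumr.
have -> : \sum_i (A h i ^+ 2 * B i f ^+ 2) / (c%:R * pr i) - s ^+ 2 / c%:R =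
    \sum_i (A h i ^+ 2 * B i f ^+ 2) / (c%:R * pr i)
    - (\sum_i A h i * B i f) * (2 * s / c%:R)
    + (\sum_i pr i) * (s ^+ 2 / c%:R).
  rewrite pr_sum1 (_ : \sum_i A h i * B i f = s); last by rewrite /s mxE.
  by field.
rewrite !mulr_suml -sumrB -big_split; apply: eq_bigr => i _ /=.
rewrite /sampled_dev /sampled_term !mxE -/(A *m B) -exprMn.
have -> : \sum_j A h j * B j f = s by rewrite /s mxE.
have [pr0|pr_neq0] := eqVneq (pr i) 0; last by field; apply/andP.
by rewrite (entry_eq0 _ _ pr0) pr0; ring.
Qed.

Lemma norm_prod_div_le i :
  col_norm2 A i * row_norm2 B i / (c%:R * pr i)
  <= norm_prod_sum A B / (beta * c%:R).
Proof.
have c_gt0' : 0 < c%:R :> R by rewrite ltr0n.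
have [pr0|pr_neq0] := eqVneq (pr i) 0.
  by rewrite pr0 mulr0 invr0 mulr0 divr_ge0 ?mulr_ge0// ltW.
have pr_gt0 : 0 < pr i by rewrite lt0r pr_neq0 pr_ge0.
rewrite !invfM mulrA mulrAC [leRHS]mulrA ler_pM2r ?invr_gt0//.
by rewrite ler_pdivrMr// norm_prod_le_pr.
Qed.

Lemma frob_norm_sampled_term_le i :
  frob_norm (sampled_term i) <= norm_prod_sum A B / (beta * c%:R).
Proof.
have c_gt0' : 0 < c%:R :> R by rewrite ltr0n.
have -> : frob_norm (sampled_term i) =
    col_norm2 A i * row_norm2 B i / (c%:R * pr i).
  rewrite -[RHS]ger0_norm; last first.
    by rewrite divr_ge0 ?norm_prod_ge0// mulr_ge0// ltW.
  rewrite -sqrtr_sqr expr_div_n -sum_sqr_entries; congr Num.sqrt.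
  rewrite mulr_suml; apply: eq_bigr => h _; rewrite mulr_suml.
  by apply: eq_bigr => f _; rewrite mxE expr_div_n exprMn.
exact: norm_prod_div_le.
Qed.

(** The common center cancels, and the two sampled terms are bounded separately, whence the factor
    2. *)
Lemma frob_norm_sampled_dev_diff_le i j :
  frob_norm (sampled_dev i - sampled_dev j)
  <= 2 * norm_prod_sum A B / (beta * c%:R).
Proof.
rewrite /sampled_dev opprB addrA subrK.
apply: le_trans (frob_normB _ _) _; rewrite mulr_natl mulr2n mulrDl.
by rewrite lerD ?frob_norm_sampled_term_le.
Qed.

(** After summing over entries, each squared norm product has one factor bounded by
    [norm_prod_div_le], while the other sums to [norm_prod_sum A B]. *)
Lemma sum_block_variance_le :
  \sum_h \sum_f (\sum_i (A h i ^+ 2 * B i f ^+ 2) / (c%:R * pr i)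
    - (A *m B) h f ^+ 2 / c%:R)
  <= (norm_prod_sum A B ^+ 2 / beta - frob_norm (A *m B) ^+ 2) / c%:R.
Proof.
have c_gt0' : 0 < c%:R :> R by rewrite ltr0n.
under eq_bigr => h _ do rewrite sumrB.
rewrite sumrB mulrBl sqr_frob_norm mulr_suml.
under [X in _ - X]eq_bigr => h _ do rewrite -mulr_suml.
rewrite lerD2r.
have -> : \sum_h \sum_f \sum_i (A h i ^+ 2 * B i f ^+ 2) / (c%:R * pr i)
    = \sum_i (col_norm2 A i * row_norm2 B i) ^+ 2 / (c%:R * pr i).
  under eq_bigr => h _ do rewrite exchange_big /=.
  rewrite exchange_big /=; apply: eq_bigr => i _; rewrite -sum_sqr_entries.
  by rewrite mulr_suml; apply: eq_bigr => h _; rewrite mulr_suml.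
rewrite -mulrA -invfM expr2 -mulrA mulr_suml; apply: ler_sum => i _.
by rewrite expr2 -mulrA ler_wpM2l ?norm_prod_ge0// norm_prod_div_le.
Qed.
End SampledTerm.

(** The [c_ k] deviations of block [k] subtract [c_ k] equal shares of the block product, hence the
    product exactly once. *)
Lemma sketch_error (R : realType) (m p K : nat) (n_ c_ : 'I_K -> nat)
    (M : 'M[R]_(m, \sum_(k < K) n_ k)) (N : 'M[R]_(\sum_(k < K) n_ k, p))
    (pr : forall k : 'I_K, 'I_(n_ k) -> R)
    (s : forall k : 'I_K, 'I_(c_ k) -> 'I_(n_ k)) :
  (forall k, (0 < c_ k)%N) -> (forall k i, 0 <= pr k i) ->
  sketch_C M pr s *m sketch_D N pr s - M *m N =
  \sum_k \sum_(t < c_ k)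
    sampled_dev (submxrow M k) (submxcol N k) (pr k) (c_ k) (s k t).
Proof.
move=> c_gt0 pr_ge0.
have -> : M *m N = \sum_k submxrow M k *m submxcol N k.
  by rewrite -mul_mxrow_mxcol submxrowK submxcolK.
rewrite mul_mxrow_mxcol -sumrB.
apply: eq_bigr => k _; rewrite /sampled_dev sumrB sumr_const card_ord.
rewrite -[X in _ = _ - X]scaler_nat scalerA.
rewrite divff ?pnatr_eq0 -?lt0n// scale1r; congr (_ - _).
apply/matrixP => h f; rewrite mxE summxE; apply: eq_bigr => t _.
rewrite !mxE mulrACA -invfM -expr2 sqr_sqrtr//.
by rewrite mulr_ge0.
Qed.

Lemma sum_tag_ord (R : pzRingType) (K : nat) (c_ : 'I_K -> nat) (F : 'I_K -> R) :
  \sum_(j : {k : 'I_K & 'I_(c_ k)}) F (tag j) = \sum_k (c_ k)%:R * F k.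
Proof.
transitivity (\sum_k \sum_(t < c_ k) F k); first by rewrite sig_big_dep.
by apply: eq_bigr => k _; rewrite sumr_const card_ord mulr_natl.
Qed.

(** * Weighted sums over the blocks *)

Section Weights.
Context {R : realType} {I : finType}.
Variables (S a : I -> R) (theta1 theta2 : R).
Hypothesis S_ge0 : forall k, 0 <= S k.
Hypothesis theta1_gt0 : 0 < theta1.
Hypothesis theta12 : theta1 <= theta2.
Hypothesis a_bounds : forall k, Num.sqrt theta1 <= a k <= Num.sqrt theta2.
Let r1 := Num.sqrt theta1.
Let r2 := Num.sqrt theta2.

Let r1_gt0 : 0 < r1. Proof. by rewrite sqrtr_gt0. Qed.
Let r12 : r1 <= r2. Proof. by rewrite ler_wsqrtr. Qed.
Let r2_gt0 : 0 < r2. Proof. exact: lt_le_trans r12. Qed.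
Let a_gt0 k : 0 < a k.
Proof. by case/andP: (a_bounds k) => ak _; exact: lt_le_trans ak. Qed.

Lemma sum_weight_le : \sum_k S k * a k <= r2 * \sum_k S k.
Proof.
rewrite mulr_sumr; apply: ler_sum => k _.
by rewrite mulrC ler_wpM2r//; case/andP: (a_bounds k).
Qed.

Lemma sum_weight_ge0 : 0 <= \sum_k S k * a k.
Proof. by apply: sumr_ge0 => k _; rewrite mulr_ge0// ltW. Qed.

Lemma sum_inv_weight_le : \sum_k S k / a k <= (\sum_k S k) / r1.
Proof.
rewrite mulr_suml; apply: ler_sum => k _; rewrite ler_wpM2l// lef_pV2 ?posrE//.
by case/andP: (a_bounds k).
Qed.

Lemma sum_weightM_le : (\sum_k S k * a k) * (\sum_k S k / a k)
  <= Num.sqrt (theta2 / theta1) * (\sum_k S k) ^+ 2.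
Proof.
rewrite sqrtrM ?(le_trans (ltW theta1_gt0))// sqrtrV ?(ltW theta1_gt0)// -/r1 -/r2.
have -> : r2 / r1 * (\sum_k S k) ^+ 2 = (r2 * \sum_k S k) * ((\sum_k S k) / r1).
  by ring.
apply: ler_pM; [exact: sum_weight_ge0| |exact: sum_weight_le|exact: sum_inv_weight_le].
by apply: sumr_ge0 => k _; rewrite divr_ge0// ltW.
Qed.

Variable beta : R.
Hypothesis theta2_le1 : theta2 <= 1.
Hypothesis beta_gt0 : 0 < beta.
Hypothesis beta_le1 : beta <= 1.

Lemma phi_num_ge0 : 0 <= theta2 - theta1 * beta + theta2 * theta1 * beta.
Proof.
have theta2_ge0 : 0 <= theta2 := le_trans (ltW theta1_gt0) theta12.
rewrite addr_ge0 ?mulr_ge0 ?(ltW beta_gt0) ?(ltW theta1_gt0)//.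
by rewrite subr_ge0 (le_trans _ theta12)// ler_piMr// ltW.
Qed.

Lemma sqr_phi_const : phi_const theta1 theta2 beta ^+ 2 =
  (theta2 - theta1 * beta + theta2 * theta1 * beta) / (r1 * r2).
Proof.
have theta_ge0 : 0 <= theta2 * theta1.
  by rewrite mulr_ge0 ?(le_trans (ltW theta1_gt0))// ltW.
rewrite /phi_const expr_div_n sqr_sqrtr ?phi_num_ge0//; congr (_ / _).
rewrite -powR_mulrn ?powR_ge0// -powRrM.
have -> : 4^-1 * 2%:R = 2^-1 :> R by field.
by rewrite powR12_sqrt// sqrtrM ?(le_trans (ltW theta1_gt0))// mulrC.
Qed.

Lemma phi_const_ge0 : 0 <= phi_const theta1 theta2 beta.
Proof. by rewrite divr_ge0 ?sqrtr_ge0 ?powR_ge0. Qed.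

(** The factor [(1 - beta) / a k + beta * a k] is [beta / a k] times [1 / beta - v k ^+ 2], with
    [v k ^+ 2 = 1 - a k ^+ 2]; the division by [a k] comes from the block size. *)
Lemma sum_variance_weight_le :
  (\sum_k S k * a k) * (\sum_k S k * ((1 - beta) / a k + beta * a k))
  <= phi_const theta1 theta2 beta ^+ 2 * (\sum_k S k) ^+ 2.
Proof.
set T := \sum_k S k.
have T_ge0 : 0 <= T by exact: sumr_ge0.
have -> : \sum_k S k * ((1 - beta) / a k + beta * a k)
    = (1 - beta) * (\sum_k S k / a k) + beta * (\sum_k S k * a k).
  by rewrite !mulr_sumr -big_split; apply: eq_bigr => k _ /=; ring.
have beta'_ge0 : 0 <= 1 - beta by rewrite subr_ge0.
(* Each sum is bounded by the extreme values [r1] and [r2] of [a k], which leaves an inequality in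
   [r1], [r2] and [beta]. *)
apply: (@le_trans _ _ ((r2 * T) * ((1 - beta) * (T / r1) + beta * (r2 * T)))).
  apply: ler_pM => //; [exact: sum_weight_ge0| |exact: sum_weight_le|].
    apply: addr_ge0; apply: mulr_ge0 => //; [|exact: ltW|exact: sum_weight_ge0].
    by apply: sumr_ge0 => k _; rewrite divr_ge0// ltW.
  apply: lerD; apply: ler_wpM2l; rewrite ?(ltW beta_gt0)//.
    exact: sum_inv_weight_le.
  exact: sum_weight_le.
have -> : r2 * T * ((1 - beta) * (T / r1) + beta * (r2 * T))
    = (r2 * ((1 - beta) / r1 + beta * r2)) * T ^+ 2 by ring.
rewrite ler_wpM2r ?sqr_ge0// sqr_phi_const ler_pdivlMr ?mulr_gt0//.
have r1_sqr : theta1 = r1 ^+ 2 by rewrite sqr_sqrtr// ltW.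
have r2_sqr : theta2 = r2 ^+ 2 by rewrite sqr_sqrtr// (le_trans _ theta12)// ltW.
have -> : r2 * ((1 - beta) / r1 + beta * r2) * (r1 * r2)
    = (1 - beta) * r2 ^+ 2 + beta * (r1 * r2 * r2 ^+ 2).
  by field; rewrite gt_eqF.
rewrite r1_sqr r2_sqr.
have r2_le1 : r2 ^+ 2 <= 1 by rewrite -r2_sqr.
(* The difference of the two sides is
   [beta * (r2 - r1) * (r1 + r2 - r1 * r2 ^+ 2)]. *)
have diff_ge0 : 0 <= (r2 - r1) * (r2 + r1 * (1 - r2 ^+ 2)).
  rewrite mulr_ge0 ?subr_ge0// addr_ge0 ?(ltW r2_gt0)//.
  by rewrite mulr_ge0 ?subr_ge0// ltW.
rewrite -subr_ge0.
have -> : r2 ^+ 2 - r1 ^+ 2 * beta + r2 ^+ 2 * r1 ^+ 2 * beta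
    - ((1 - beta) * r2 ^+ 2 + beta * (r1 * r2 * r2 ^+ 2))
    = beta * ((r2 - r1) * (r2 + r1 * (1 - r2 ^+ 2))) by ring.
by rewrite mulr_ge0// ltW.
Qed.

End Weights.

(** * Variance and tail bounds for the sketch *)

Theorem theorem4 (R : realType) (m p K : nat) (n_ c_ : 'I_K -> nat) (c : nat)
  (M : 'M[R]_(m, \sum_(k < K) n_ k)) (N : 'M[R]_(\sum_(k < K) n_ k, p))
  (pr : forall k : 'I_K, 'I_(n_ k) -> R)
  (v : 'I_K -> R) (theta1 theta2 beta : R)
  (d : measure_display) (T : measurableType d) (P : probability T R)
  (idx : forall k : 'I_K, 'I_(c_ k) -> T -> 'I_(n_ k))
  (c_bounds : forall k, (1 <= c_ k <= n_ k)%N)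
  (c_sum : (\sum_(k < K) c_ k)%N = c)
  (pr_ge0 : forall k i, 0 <= pr k i)
  (pr_sum1 : forall k, \sum_(i < n_ k) pr k i = 1)
  (norm_prod_sum_neq0 :
    forall k, norm_prod_sum (submxrow M k) (submxcol N k) != 0)
  (block_weight_sum_neq0 : \sum_(l < K) block_weight M N l != 0)
  (v_bounds : forall k, 0 <= v k <= 1)
  (v_def : forall k, v k * norm_prod_sum (submxrow M k) (submxcol N k)
                     = frob_norm (submxrow M k *m submxcol N k))
  (theta1_gt0 : 0 < theta1) (theta12 : theta1 <= theta2) (theta2_le1 : theta2 <= 1)
  (v_theta : forall k, theta1 <= 1 - v k ^+ 2 <= theta2)
  (beta_gt0 : 0 < beta) (beta_le1 : beta <= 1)
  (pr_lower : forall k i,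
    beta * col_norm2 (submxrow M k) i * row_norm2 (submxcol N k) i
      / norm_prod_sum (submxrow M k) (submxcol N k) <= pr k i)
  (c_def : forall k, (c_ k)%:R =
    c%:R * block_weight M N k / \sum_(l < K) block_weight M N l)
  (sampling : block_sampling P pr idx) :
  \sum_(h < m) \sum_(f < p) asym_var c_ M N pr h f
    <= phi_const theta1 theta2 beta ^+ 2 / (beta * c%:R)
       * frob_norm M ^+ 2 * frob_norm N ^+ 2
  /\
  forall delta : R, 0 < delta < 1 ->
    ((1 - delta)%:E <=
     P [set w | let s := fun k t => idx k t w in
          (frob_norm (M *m N - sketch_C M pr s *m sketch_D N pr s) ^+ 2
           <= eta_const theta1 theta2 beta delta ^+ 2 / (beta * c%:R)
              * frob_norm M ^+ 2 * frob_norm N ^+ 2)%R])%E.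
Proof.
pose S k := norm_prod_sum (submxrow M k) (submxcol N k).
have S_gt0 k : 0 < S k.
  rewrite /S lt0r norm_prod_sum_neq0 /=; apply: sumr_ge0 => i _.
  exact: norm_prod_ge0.
pose a k := Num.sqrt (1 - v k ^+ 2).
have S_ge0 k : 0 <= S k := ltW (S_gt0 k).
have a_bounds k : Num.sqrt theta1 <= a k <= Num.sqrt theta2.
  by case/andP: (v_theta k) => ? ?; rewrite !ler_wsqrtr.
have a_gt0 k : 0 < a k.
  by case/andP: (a_bounds k) => ak _; apply: lt_le_trans ak; rewrite sqrtr_gt0.
have sqr_a k : a k ^+ 2 = 1 - v k ^+ 2.
  rewrite sqr_sqrtr//; case/andP: (v_theta k) => + _.
  exact/le_trans/ltW.
have weightE k : block_weight M N k = S k * a k.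
  rewrite /block_weight -v_def -/(S k) exprMn.
  have -> : S k ^+ 2 - v k ^+ 2 * S k ^+ 2 = S k ^+ 2 * (1 - v k ^+ 2) by ring.
  by rewrite sqrtrM ?sqr_ge0// sqrtr_sqr ger0_norm.
pose W := \sum_k S k * a k.
have sum_weightE : \sum_k block_weight M N k = W.
  by apply: eq_bigr => k _; exact: weightE.
(* A nonzero sum of weights has at least one term; this block makes [W] and [c] positive. *)
have [k0 _] : exists k0 : 'I_K, True.
  case: (pickP 'I_K) => [k0 _|no_k]; first by exists k0.
  by move: block_weight_sum_neq0; rewrite big1 ?eqxx// => k; have := no_k k.
have W_gt0 : 0 < W.
  rewrite /W (bigD1 k0)//= ltr_pwDl ?mulr_gt0//.
  by apply: sumr_ge0 => k _; rewrite mulr_ge0// ltW.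
have ck_gt0 k : (0 < c_ k)%N by case/andP: (c_bounds k).
have c_gt0 : 0 < c%:R :> R.
  rewrite ltr0n -c_sum (bigD1 k0)//=.
  exact: leq_trans (ck_gt0 k0) (leq_addr _ _).
have ckE k : (c_ k)%:R = c%:R * (S k * a k) / W :> R.
  by rewrite c_def weightE sum_weightE.
have neq0 k : [/\ S k != 0, a k != 0, W != 0, c%:R != 0 :> R & beta != 0].
  by split; rewrite gt_eqF.
pose F := frob_norm M * frob_norm N.
have F_ge0 : 0 <= F by rewrite mulr_ge0 ?frob_norm_ge0.
have sum_S_le : \sum_k S k <= F by exact: sum_norm_prod_sum_le.
have sum_S_sqr_le : (\sum_k S k) ^+ 2 <= F ^+ 2.
  by rewrite ler_sqr ?nnegrE// sumr_ge0.
set phi := phi_const theta1 theta2 beta.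
have phi_ge0 : 0 <= phi by exact: phi_const_ge0.
have asym_varE h f : asym_var c_ M N pr h f = \sum_k
    (\sum_(i < n_ k) (submxrow M k h i ^+ 2 * submxcol N k i f ^+ 2)
       / ((c_ k)%:R * pr k i)
     - (submxrow M k *m submxcol N k) h f ^+ 2 / (c_ k)%:R).
  by rewrite sumrB.
have variance_le : \sum_h \sum_f asym_var c_ M N pr h f
    <= phi ^+ 2 / (beta * c%:R) * F ^+ 2.
  under eq_bigr => h _ do (under eq_bigr => f _ do rewrite asym_varE;
    rewrite exchange_big /=).
  rewrite exchange_big /=.
  apply: (@le_trans _ _ ((beta * c%:R)^-1 *
      (W * \sum_k S k * ((1 - beta) / a k + beta * a k)))).
    rewrite !mulr_sumr; apply: ler_sum => k _.
    apply: le_trans (sum_block_variance_le (pr_ge0 k) (ck_gt0 k) beta_gt0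
      (S_gt0 k) (pr_lower k)) _.
    rewrite -/(S k) -v_def -/(S k) exprMn ckE.
    rewrite (_ : v k ^+ 2 = 1 - a k ^+ 2); last by rewrite sqr_a subKr.
    by case: (neq0 k) => ? ? ? ? ?; rewrite le_eqVlt; apply/orP; left;
      apply/eqP; field; do ?[apply/andP; split].
  rewrite [leRHS]mulrAC [leRHS]mulrC ler_wpM2l//.
    by rewrite invr_ge0 mulr_ge0// ltW.
  apply: le_trans (sum_variance_weight_le S_ge0 theta1_gt0 theta12 a_bounds
    theta2_le1 beta_gt0 beta_le1) _.
  by rewrite ler_wpM2l ?sqr_ge0.
split=> [|delta delta_bounds].
  by rewrite -mulrA -exprMn.
pose J : finType := {k : 'I_K & 'I_(c_ k)}.
pose q (j : J) (x : 'I_(n_ (tag j))) := pr (tag j) x.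
pose Y (j : J) (x : 'I_(n_ (tag j))) := sampled_dev
  (submxrow M (tag j)) (submxcol N (tag j)) (pr (tag j)) (c_ (tag j)) x.
pose X (j : J) (w : T) := idx (tag j) (tagged j) w.
pose D (j : J) := 2 * S (tag j) / (beta * (c_ (tag j))%:R).
pose g (s : forall j : J, 'I_(n_ (tag j))) := frob_norm (\sum_j Y j (s j)).
have q_ge0 (j : J) x : 0 <= q j x by exact: pr_ge0.
have q_sum1 (j : J) : \sum_x q j x = 1 by exact: pr_sum1.
have Y_mean0 (j : J) h f : \sum_x q j x * Y j x h f = 0.
  exact: (sampled_dev_mean0 (pr_sum1 _) (ck_gt0 _) beta_gt0
    (S_gt0 _) (pr_lower _)).
have Y_diff (j : J) x y : frob_norm (Y j x - Y j y) <= D j.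
  exact: (frob_norm_sampled_dev_diff_le (pr_ge0 _) (ck_gt0 _) beta_gt0
    (S_gt0 _) (pr_lower _)).
(* Second moments add over the [c_ k] draws of each block and reproduce the asymptotic variance
   exactly. *)
have second_momentE :
    \sum_h \sum_f \sum_j \sum_x q j x * Y j x h f ^+ 2
    = \sum_h \sum_f asym_var c_ M N pr h f.
  apply: eq_bigr => h _; apply: eq_bigr => f _; rewrite asym_varE.
  apply: etrans (sum_tag_ord c_ (fun k => \sum_x pr k x *
    sampled_dev (submxrow M k) (submxcol N k) (pr k) (c_ k) x h f ^+ 2)) _.
  apply: eq_bigr => k _.
  exact: (sampled_dev_second_moment (pr_sum1 _) (ck_gt0 _) beta_gt0
    (S_gt0 _) (pr_lower _)).
(* Block [k] contributes [c_ k] equal squares, and its prescribed size turns [S k / c_ k] into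
   [W / (c * a k)]. *)
have sum_D : \sum_j D j ^+ 2 = 4 / (beta ^+ 2 * c%:R) * (W * \sum_k S k / a k).
  apply: etrans (sum_tag_ord c_ (fun k => (2 * S k / (beta * (c_ k)%:R)) ^+ 2)) _.
  rewrite !mulr_sumr; apply: eq_bigr => k _; rewrite ckE.
  by case: (neq0 k) => ? ? ? ? ?; field; do ?[apply/andP; split].
have sum_D_gt0 : 0 < \sum_j D j ^+ 2.
  rewrite sum_D mulr_gt0 ?divr_gt0 ?mulr_gt0 ?exprn_gt0//.
  rewrite (bigD1 k0)//= ltr_pwDl ?divr_gt0//.
  by apply: sumr_ge0 => k _; rewrite divr_ge0// ltW.
set L := ln (1 / delta).
have L_ge0 : 0 <= L.
  case/andP: delta_bounds => ? ?.
  by apply: ln_ge0; rewrite ler_pdivlMr// mul1r ltW.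
set eta := eta_const theta1 theta2 beta delta.
(* [B] is the unit of the bounds: the claim becomes [g s <= eta * B], without squares. *)
have [B B_ge0 sqr_B] : exists2 B, 0 <= B & B ^+ 2 = F ^+ 2 / (beta * c%:R).
  exists (F / Num.sqrt (beta * c%:R)); first by rewrite divr_ge0 ?sqrtr_ge0.
  by rewrite expr_div_n [X in _ / X]sqr_sqrtr// mulr_ge0// ltW.
pose b := eta * B.
have ratio_ge1 : 1 <= theta2 / theta1 by rewrite ler_pdivlMr// mul1r.
have ratio_ge0 : 0 <= theta2 / theta1 := le_trans ler01 ratio_ge1.
have s0 : forall j : J, 'I_(n_ (tag j)).
  move=> j; apply: (@Ordinal _ 0).
  by case/andP: (c_bounds (tag j)) => ck nk; exact: leq_trans ck nk.
have mean_le : iter_mean q (enum J) g s0 <= phi * B.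
  apply: le_trans (iter_mean_frob_norm_le q_ge0 q_sum1 _ Y_mean0) _.
  rewrite second_momentE -[leRHS](ger0_norm (mulr_ge0 phi_ge0 B_ge0)).
  rewrite -sqrtr_sqr ler_wsqrtr// exprMn sqr_B.
  by apply: le_trans variance_le _; rewrite [leLHS]mulrAC [leRHS]mulrA.
(* The 8 in [eta_const] is the 2 of the tail bound times the 4 in [sum_D]. *)
have dev_le : Num.sqrt (2 * (\sum_j D j ^+ 2) * L)
    <= Num.sqrt (theta2 / theta1) * Num.sqrt (8 / beta * L)
       * B.
  have beta8_ge0 : 0 <= 8 / beta * L by rewrite mulr_ge0// divr_ge0// ltW.
  rewrite -[leRHS]ger0_norm; last first.
    by rewrite !mulr_ge0 ?sqrtr_ge0.
  rewrite -sqrtr_sqr ler_wsqrtr// !exprMn sqr_B !sqr_sqrtr// sum_D.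
  (* [sum_weightM_le] yields the square root of the ratio; it is enlarged to the ratio, whose root
     then appears in [eta_const]. *)
  have ratio_sqrt : Num.sqrt (theta2 / theta1) <= theta2 / theta1.
    rewrite -[leRHS]sqr_sqrtr// expr2 ler_peMr ?sqrtr_ge0//.
    by rewrite -sqrtr1 ler_wsqrtr.
  have sum_le : W * (\sum_k S k / a k) <= theta2 / theta1 * F ^+ 2.
    apply: le_trans (sum_weightM_le S_ge0 theta1_gt0 theta12 a_bounds) _.
    by apply: ler_pM; rewrite ?sqrtr_ge0 ?sqr_ge0.
  have coef_ge0 : 0 <= 8 * L / (beta ^+ 2 * c%:R).
    by rewrite divr_ge0 ?mulr_ge0 ?exprn_ge0 ?(ltW c_gt0) ?(ltW beta_gt0).
  case: (neq0 k0) => _ _ _ c_neq0 beta_neq0.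
  have -> : 2 * (4 / (beta ^+ 2 * c%:R) * (W * (\sum_k S k / a k))) * L
      = 8 * L / (beta ^+ 2 * c%:R) * (W * (\sum_k S k / a k)).
    by field; apply/andP.
  have -> : theta2 / theta1 * (8 / beta * L) * (F ^+ 2 / (beta * c%:R))
      = 8 * L / (beta ^+ 2 * c%:R) * (theta2 / theta1 * F ^+ 2).
    by field; rewrite ?gt_eqF// c_neq0 beta_neq0.
  exact: ler_wpM2l.
have eta_ge0 : 0 <= eta.
  by rewrite addr_ge0// mulr_ge0 ?sqrtr_ge0.
have b_ge0 : 0 <= b by rewrite mulr_ge0.
have tail_b : iter_mean q (enum J) (fun s => (b < g s)%R%:R) s0 <= delta.
  apply: (iter_mean_tail_le q_ge0 q_sum1 (frob_norm_sum_diff Y_diff)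
    sum_D_gt0 delta_bounds).
  by apply: le_trans (lerD mean_le dev_le) _; rewrite -mulrDl.
pose E (s : forall j : J, 'I_(n_ (tag j))) :=
  frob_norm (M *m N - sketch_C M pr (fun k t => s (Tagged (fun k => 'I_(c_ k)) t))
    *m sketch_D N pr (fun k t => s (Tagged (fun k => 'I_(c_ k)) t))) ^+ 2
  <= eta ^+ 2 / (beta * c%:R) * frob_norm M ^+ 2 * frob_norm N ^+ 2.
(* This pointwise bound is affine in the indicator of the bad event, so linearity and monotonicity
   of the mean turn [tail_b] into the lower bound [1 - delta]. *)
have E_tail s : 1 + (-1) * (b < g s)%R%:R <= (E s)%:R :> R.
  case: ltP => [_|gb]; first by rewrite mulr1 subrr ler0n.
  rewrite mulr0 addr0 (_ : E s = true)//.
  rewrite /E -frob_normN opprB sketch_error//.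
  have -> : \sum_k \sum_(t < c_ k) sampled_dev (submxrow M k) (submxcol N k)
      (pr k) (c_ k) (s (Tagged (fun k => 'I_(c_ k)) t)) = \sum_j Y j (s j).
    by rewrite sig_big_dep; apply: eq_bigr => -[k t] _.
  rewrite -[leRHS]mulrA -exprMn -/F.
  have -> : eta ^+ 2 / (beta * c%:R) * F ^+ 2 = b ^+ 2.
    by rewrite /b [RHS]exprMn sqr_B [RHS]mulrA [LHS]mulrAC.
  by rewrite ler_sqr ?nnegrE ?frob_norm_ge0.
case: sampling => meas law indep.
have X_measurable (j : J) (A : set 'I_(n_ (tag j))) : measurable (X j @^-1` A).
  exact: meas.
have X_law (j : J) x : P (X j @^-1` [set x]) = (q j x)%:E by exact: law.
have PE := probability_sample_event X_measurable X_law indep E s0.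
apply: (@le_trans _ _ (P [set w | E (X ^~ w)])) => //; rewrite PE.
rewrite lee_fin; apply: le_trans (iter_mean_le q_ge0 (enum J) E_tail s0).
by rewrite iter_meanD iter_meanZ iter_mean_cst// mulN1r lerD2l lerN2.
Qed.
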